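(* For every integer $n\ge 1$ the following identities hold: (i) $\tau(n) = \frac{5}{12} n\sigma_{3}(n) + \frac{7}{12} n\sigma_5(n) +70 \sum_{m=1}^{n-1}(2n-5m)\sigma_3(m)\sigma_5(n-m)$; (ii) $\tau(n) = n^2\sigma_{3}(n) + 60 \sum_{m=1}^{n-1}(4n^2-13mn+9m^2)\sigma_3(m)\sigma_3(n-m)$; (iii) $\tau(n) = \frac{65}{756} \sigma_{11}(n) + \frac{5\cdot691}{12\cdot 756\, n} \sigma_7(n) + \frac{691}{12\cdot 108\, n} \sigma_5(n) - \frac{5\cdot 691}{54 n^2} \sum_{m=1}^{n-1}(3n - 7m)\sigma_5(m)\sigma_7(n-m) -\frac{13\cdot 691}{9 n^2}\sum_{m=1}^{n-1}m(n-m)\sigma_5(m)\sigma_5(n-m)$; (iv) $\tau(n) = \frac{65}{756} \sigma_{11}(n) + \frac{3\cdot691}{8\cdot441} \sigma_3(n) + \frac{5\cdot 691}{24\cdot441} \sigma_7(n) + \frac{5\cdot 691}{441 n^2} \sum_{m=1}^{n-1}(91m^2 - 65 mn + 10n^2) \sigma_3(m)\sigma_7(n-m) -\frac{13\cdot 691}{9 n^2}\sum_{m=1}^{n-1}m(n-m)\sigma_5(m)\sigma_5(n-m)$; (v) $\tau(n) = \frac{65}{756} \sigma_{11}(n) + \frac{25\cdot691}{36\cdot 756\, n} \sigma_3(n) + \frac{11\cdot691}{36\cdot 756\, n} \sigma_9(n) - \frac{55\cdot 691}{1134 n^2} \sum_{m=1}^{n-1}(7m-2n)\sigma_3(m)\sigma_9(n-m)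 -\frac{13\cdot 691}{9 n^2}\sum_{m=1}^{n-1}m(n-m)\sigma_5(m)\sigma_5(n-m)$.
   Context: $\tau(n)$ is Ramanujan's tau function, defined by $q\prod_{n\ge 1}(1-q^n)^{24} = \sum_{n\ge 1}\tau(n)q^n$. For $k\ge 1$, $\sigma_k(n)=\sum_{d\mid n} d^k$ (sum over positive divisors of $n$). For $n=1$ the sum $\sum_{m=1}^{n-1}$ is empty and equals $0$. *)

(* Defs.v *)
From mathcomp Require Import all_boot all_order all_algebra.

Set Implicit Arguments.
Unset Strict Implicit.
Unset Printing Implicit Defensive.

Import GRing.Theory.
Local Open Scope ring_scope.

Definition sigma (k n : nat) : nat := (\sum_(d <- divisors n) d ^ k)%N.

Definition delta_partial (N : nat) : {poly int} :=
  'X * \prod_(1 <= k < N.+1) (1 - 'X^k) ^+ 24.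

(* The coefficient of q^n in the formal infinite product
   q \prod_(k >= 1) (1 - q^k)^24: the factors with k > n do not affect it, so
   the partial product up to k = n suffices (see delta_partial_coef). *)
Definition tau (n : nat) : int := (delta_partial n)`_n.

Lemma delta_partial_coef (n N : nat) : (n <= N)%N -> (delta_partial N)`_n = tau n.
Proof.
move=> /subnK <-; elim: (N - n)%N => [//|d <-]; rewrite addSn.
have [q Eq] : exists q : {poly int},
    (1 - 'X^((d + n).+1)) ^+ 24 = 1 + q * 'X^((d + n).+1).
  elim: 24%N => [|e [q IHe]]; first by exists 0; rewrite expr0 mul0r addr0.
  exists ((1 - 'X^((d + n).+1)) * q - 1).
  by rewrite exprS IHe mulrDr mulr1 [in RHS]mulrBl mul1r mulrA addrAC addrA.
rewrite /delta_partial big_nat_recr //= Eq mulrDr mulr1 mulrDr coefD.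
by rewrite !mulrA coefMXn ltnS leq_addl addr0.
Qed.

(* Main.v *)
(* Let S_k be the power series with coefficients sigma_k(n), and theta = q d/dq.
   On the representations n = a x + b y, the map (a, x, b, y) |->
   (a, x - y, a + b, y) carries the ones with y < x onto the ones with a < b.
   Hence, if h(a, b) is symmetric and h(a, a + b) = h(b, a + b), the sum of
   h(a, b) - h(a, a + b) over all of them reduces to its diagonal terms, which
   are divisor sums.  Such polynomials h are the invariants of a dihedral group
   of order 12, generated by a^2 - a b + b^2 and (a b (a - b))^2.  Six of them
   give Ramanujan's differential equations for E2, E4, E6 together with
   E8 = E4^2, E10 = E4 E6 and 691 E12 = 441 E4^3 + 250 E6^2.  Since the
   logarithmic derivative of the product defining Delta is E2, both Delta and
   E4^3 - E6^2 solve theta f = E2 f, so 1728 Delta = E4^3 - E6^2.  The five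
   identities are then polynomial identities in E2, E4, E6. *)
From HB Require Import structures.
Require Import Defs.
From mathcomp Require Import all_boot all_order all_algebra.
From mathcomp Require Import boolp zify ring lra.

Import GRing.Theory.
Local Open Scope ring_scope.

(** * The ring of formal power series and its derivation *)

(** A wrapper, so that the Cauchy product can be attached to coefficient sequences without meeting
    any pointwise structure on functions. *)
Record fps := Fps { fcoef :> nat -> rat }.

HB.instance Definition _ := gen_eqMixin fps.
HB.instance Definition _ := gen_choiceMixin fps.

Lemma fpsP (f g : fps) : f =1 g -> f = g.
Proof. by case: f g => [f] [g] /= /funext ->. Qed.

Definition fps_add (f g : fps) := Fps (fun n => f n + g n).
Definition fps_opp (f : fps) := Fps (fun n => - f n).
Definition fps_mul (f g : fps) := Fps (fun n => \sum_(i < n.+1) f i * g (n - i)%N).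
Definition fps_one := Fps (fun n => (n == 0%N)%:R).

Fact fps_addA : associative fps_add.
Proof. by move=> f g h; apply: fpsP => n; apply: addrA. Qed.

Fact fps_addC : commutative fps_add.
Proof. by move=> f g; apply: fpsP => n; apply: addrC. Qed.

Fact fps_add0 : left_id (Fps (fun=> 0)) fps_add.
Proof. by move=> f; apply: fpsP => n; apply: add0r. Qed.

Fact fps_addN : left_inverse (Fps (fun=> 0)) fps_opp fps_add.
Proof. by move=> f; apply: fpsP => n; apply: addNr. Qed.

HB.instance Definition _ := GRing.isZmodule.Build fps
  fps_addA fps_addC fps_add0 fps_addN.

(** Coefficients of index at most [n] in a product depend only on the truncations at [n], so
    commutativity and associativity are inherited from polynomials. *)
Definition fps_trunc (n : nat) (f : fps) : {poly rat} := \poly_(i < n.+1) f i.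

Lemma coef_fps_trunc (n i : nat) (f : fps) : (i <= n)%N -> (fps_trunc n f)`_i = f i.
Proof. by move=> le_in; rewrite coef_poly ltnS le_in. Qed.

Lemma coef_fps_mul (n i : nat) (f g : fps) : (i <= n)%N ->
  fps_mul f g i = (fps_trunc n f * fps_trunc n g)`_i.
Proof.
move=> le_in; rewrite coefM; apply: eq_bigr => -[j /=]; rewrite ltnS => le_ji _.
by rewrite !coef_fps_trunc ?(leq_trans _ le_in) ?leq_subr.
Qed.

Fact fps_mulC : commutative fps_mul.
Proof. by move=> f g; apply: fpsP => n; rewrite !(@coef_fps_mul n) // mulrC. Qed.

Fact fps_mulA : associative fps_mul.
Proof.
have mulE f g h n : fps_mul f (fps_mul g h) n
    = (fps_trunc n f * (fps_trunc n g * fps_trunc n h))`_n.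
  rewrite coefM; apply: eq_bigr => i _; have le_in : (i <= n)%N := ltn_ord i.
  by rewrite coef_fps_trunc // (@coef_fps_mul n) ?leq_subr.
move=> f g h; apply: fpsP => n; rewrite mulE [in RHS]fps_mulC mulE.
by rewrite mulrA [in RHS]mulrC.
Qed.

Fact fps_mul1 : left_id fps_one fps_mul.
Proof.
move=> f; apply: fpsP => n; rewrite /= big_ord_recl /= mul1r subn0 big1 ?addr0 //.
by move=> i _; rewrite mul0r.
Qed.

Fact fps_mulDl : left_distributive fps_mul fps_add.
Proof.
move=> f g h; apply: fpsP => n; rewrite /= -big_split.
by apply: eq_bigr => i _; rewrite mulrDl.
Qed.

Fact fps_one_neq0 : fps_one != 0.
Proof. by apply/eqP => /(congr1 (fun f : fps => f 0%N)). Qed.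

HB.instance Definition _ := GRing.Zmodule_isComNzRing.Build fps
  fps_mulA fps_mulC fps_mul1 fps_mulDl fps_one_neq0.

Arguments fcoef : simpl never.

Lemma fps_coefD (f g : fps) (n : nat) : (f + g) n = f n + g n.
Proof. by []. Qed.

Lemma fps_coefN (f : fps) (n : nat) : (- f) n = - f n.
Proof. by []. Qed.

Lemma fps_coefM (f g : fps) (n : nat) : (f * g) n = \sum_(i < n.+1) f i * g (n - i)%N.
Proof. by []. Qed.

Lemma fps_coef1 (n : nat) : (1 : fps) n = (n == 0%N)%:R.
Proof. by []. Qed.

Lemma fps_coefMn (f : fps) (k n : nat) : (f *+ k) n = f n *+ k.
Proof. by elim: k => // k IHk; rewrite !mulrS fps_coefD IHk. Qed.

Lemma fps_coef_natM (k n : nat) (f : fps) : (k%:R * f) n = k%:R * f n.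
Proof. by rewrite mulr_natl fps_coefMn mulr_natl. Qed.

(** Without constant terms both end terms of the Cauchy product vanish, which leaves exactly the
    range of the convolution sums in the theorem. *)
Lemma fps_coefM0 (f g : fps) (n : nat) : f 0%N = 0 -> g 0%N = 0 ->
  (f * g) n = \sum_(1 <= m < n) f m * g (n - m)%N.
Proof.
move=> f0 g0; rewrite fps_coefM big_ord_recl f0 mul0r add0r.
case: n => [|n]; first by rewrite big_ord0 big_geq.
rewrite big_ord_recr /= /bump add1n subnn g0 mulr0 addr0.
by rewrite big_add1 big_mkord.
Qed.

Definition theta (f : fps) : fps := Fps (fun n => n%:R * f n).

Lemma fps_coef_theta (f : fps) (n : nat) : theta f n = n%:R * f n.
Proof. by []. Qed.

Fact theta_is_additive : zmod_morphism theta.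
Proof. by move=> f g; apply: fpsP => n; apply: mulrBr. Qed.

HB.instance Definition _ := GRing.isZmodMorphism.Build fps fps theta theta_is_additive.

Lemma thetaM (f g : fps) : theta (f * g) = theta f * g + f * theta g.
Proof.
apply: fpsP => n; rewrite fps_coefD fps_coef_theta !fps_coefM mulr_sumr -big_split.
apply: eq_bigr => i _; have le_in : (i <= n)%N := ltn_ord i.
have -> : n%:R = i%:R + (n - i)%:R :> rat by rewrite -natrD subnKC.
by rewrite !fps_coef_theta /=; ring.
Qed.

Lemma theta1 : theta 1 = 0.
Proof.
apply: fpsP => n; rewrite fps_coef_theta fps_coef1.
by case: n => [|n]; rewrite ?mul0r ?mulr0.
Qed.

Lemma theta_natM (k : nat) (f : fps) : theta (k%:R * f) = k%:R * theta f.
Proof. by rewrite !mulr_natl raddfMn. Qed.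

Lemma theta_nat (k : nat) : theta k%:R = 0.
Proof. by rewrite -[k%:R]mulr1 theta_natM theta1 mulr0. Qed.

Lemma thetaX (f : fps) (m : nat) : theta (f ^+ m) = m%:R * f ^+ m.-1 * theta f.
Proof.
elim: m => [|[|m] IHm]; rewrite ?theta1 ?mul0r // ?mul1r // exprS thetaM IHm.
by rewrite -(natr1 m.+1) [f ^+ m.+1]exprS /=; ring.
Qed.

(** Stands in for division by integers: identities are proved after clearing denominators, with
    integer coefficients throughout. *)
Lemma fps_natM_inj (k : nat) (f g : fps) : (0 < k)%N -> k%:R * f = k%:R * g -> f = g.
Proof.
move=> k_gt0 eq_fg; apply: fpsP => n.
have := congr1 (fun h : fps => h n) eq_fg; rewrite !fps_coef_natM.
by apply: mulfI; rewrite Num.Theory.pnatr_eq0 -lt0n.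
Qed.

(** * Representations by [a x + b y] *)

Lemma reindex_bij_on (I J : finType) (P : pred I) (Q : pred J) (f : I -> J) (g : J -> I)
    (F : J -> rat) :
    (forall i, P i -> Q (f i) /\ g (f i) = i) ->
    (forall j, Q j -> P (g j) /\ f (g j) = j) ->
  \sum_(j | Q j) F j = \sum_(i | P i) F (f i).
Proof.
move=> fP gQ; rewrite (reindex_onto f g) => [|j /gQ[]//].
apply: eq_bigl => i; apply/andP/idP => [[/gQ[Pgf _] /eqP <-] // | /fP[-> ->]].
by rewrite eqxx.
Qed.

(** In a representation of [n] with positive entries every entry is at most [n], so a finite type
    contains them all. *)
Definition quad (n : nat) : finType := ('I_n.+1 * 'I_n.+1 * ('I_n.+1 * 'I_n.+1))%type.

Definition reps (n : nat) (p : quad n) : bool :=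
  let: ((a, x), (b, y)) := p in
  [&& 0 < a, 0 < x, 0 < b, 0 < y & a * x + b * y == n]%N.

Definition rsum (n : nat) (P : nat -> nat -> nat -> nat -> bool)
    (F : nat -> nat -> nat -> nat -> rat) : rat :=
  \sum_(p : quad n | reps n p && P p.1.1 p.1.2 p.2.1 p.2.2) F p.1.1 p.1.2 p.2.1 p.2.2.

(** The shear preserves the represented number, since a (x - y) + (a + b) y = a x + b y. *)
Lemma rsum_shear (n : nat) (F : nat -> nat -> rat) :
  rsum n (fun a x b y => (a < b)%N) (fun a x b y => F a b) =
  rsum n (fun a x b y => (y < x)%N) (fun a x b y => F a (a + b)%N).
Proof.
(* The default value of [inord] never intervenes: on the representations concerned, the new entries
   are again at most [n]. *)
pose f (p : quad n) : quad n :=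
  ((p.1.1, inord (p.1.2 - p.2.2)), (inord (p.1.1 + p.2.1), p.2.2)).
pose g (p : quad n) : quad n :=
  ((p.1.1, inord (p.1.2 + p.2.2)), (inord (p.2.1 - p.1.1), p.2.2)).
rewrite /rsum (@reindex_bij_on _ _
  (fun p : quad n => reps n p && (p.2.2 < p.1.2)%N) _ f g) /=.
- apply: eq_bigr => -[[a x] [b y]] /= /andP[/and5P[a0 x0 b0 y0 /eqP En] lt_yx].
  by rewrite inordK //; nia.
- move=> [[a x] [b y]] /= /andP[/and5P[a0 x0 b0 y0 /eqP En] lt_yx].
  have x_le : (x - y < n.+1)%N by nia.
  have b_le : (a + b < n.+1)%N by nia.
  rewrite /f /g /= !inordK //; split; first by rewrite a0 y0 /=; apply/andP; split; nia.
  by rewrite subnK 1?ltnW // addKn !inord_val.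
- move=> [[a x] [b y]] /= /andP[/and5P[a0 x0 b0 y0 /eqP En] lt_ab].
  have x_le : (x + y < n.+1)%N by nia.
  have b_le : (b - a < n.+1)%N by nia.
  rewrite /f /g /= !inordK //; split; first by rewrite a0 y0 /=; apply/andP; split; nia.
  by rewrite addnK subnKC 1?ltnW // !inord_val.
Qed.

Lemma rsum_swap (n : nat) P F :
  rsum n P F = rsum n (fun a x b y => P b y a x) (fun a x b y => F b y a x).
Proof.
pose f (p : quad n) : quad n := (p.2, p.1).
apply: (@reindex_bij_on _ _ _ _ f f);
by move=> [[a x] [b y]] /= /andP[/and5P[a0 x0 b0 y0 En] lt_yx];
  rewrite a0 x0 b0 y0 addnC En lt_yx.
Qed.

Lemma rsum_transpose (n : nat) P F :
  rsum n P F = rsum n (fun a x b y => P x a y b) (fun a x b y => F x a y b).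
Proof.
pose f (p : quad n) : quad n := ((p.1.2, p.1.1), (p.2.2, p.2.1)).
apply: (@reindex_bij_on _ _ _ _ f f);
by move=> [[a x] [b y]] /= /andP[/and5P[a0 x0 b0 y0 En] lt_yx];
  rewrite a0 x0 b0 y0 [(x * a)%N]mulnC [(y * b)%N]mulnC En lt_yx.
Qed.

Lemma rsum_split (n : nat) (c d : nat -> nat -> nat -> nat -> nat) F :
  rsum n (fun _ _ _ _ => true) F =
  rsum n (fun a x b y => (c a x b y < d a x b y)%N) F
  + rsum n (fun a x b y => (d a x b y < c a x b y)%N) F
  + rsum n (fun a x b y => c a x b y == d a x b y) F.
Proof.
rewrite /rsum !big_mkcondr -!big_split /=; apply: eq_bigr => p _.
by case: ltngtP; rewrite ?addr0 ?add0r.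
Qed.

Lemma eq_rsum (n : nat) (P : nat -> nat -> nat -> nat -> bool)
    (F G : nat -> nat -> nat -> nat -> rat) :
    (forall a x b y, (0 < a)%N -> (0 < b)%N -> P a x b y -> F a x b y = G a x b y) ->
  rsum n P F = rsum n P G.
Proof.
move=> eqFG; apply: eq_bigr => -[[a x] [b y]] /= /andP[/and5P[a0 x0 b0 y0 En]].
exact: eqFG.
Qed.

(** On [x = y] the equation reads (a + b) x = n, so d = a + b divides [n] and [a] runs freely below
    d. *)
Lemma rsum_diag (n : nat) (F : nat -> nat -> nat -> rat) :
  rsum n (fun a x b y => x == y) (fun a x b y => F a b x) =
  \sum_(q : 'I_n.+1 * 'I_n.+1 | (q.1 * q.2 == n)%N && (0 < q.2)%N)
    \sum_(1 <= a < q.1) F a (q.1 - a)%N q.2.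
Proof.
under eq_bigr => q _.
  rewrite (big_nat_widen _ _ n.+1) ?big_geq_mkord /=; last by rewrite ltnW.
  over.
rewrite pair_big_dep /=.
pose f (p : 'I_n.+1 * 'I_n.+1 * 'I_n.+1) : quad n :=
  ((p.2, p.1.2), (inord (p.1.1 - p.2), p.1.2)).
pose g (p : quad n) : 'I_n.+1 * 'I_n.+1 * 'I_n.+1 :=
  ((inord (p.1.1 + p.2.1), p.1.2), p.1.1).
rewrite /rsum (@reindex_bij_on _ _ (fun p : 'I_n.+1 * 'I_n.+1 * 'I_n.+1 =>
  (p.1.1 * p.1.2 == n)%N && (0 < p.1.2)%N && ((p.2 < p.1.1)%N && (0 < p.2)%N)) _ f g) /=.
- apply: eq_bigr => -[[d x] a] /= _.
  by rewrite inordK // (leq_ltn_trans (leq_subr _ _)).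
- move=> [[d x] a] /= /and3P[/andP[/eqP En x0] lt_ad a0].
  have d_le : (d - a < n.+1)%N by rewrite (leq_ltn_trans (leq_subr _ _)).
  rewrite /f /g /= !inordK // eqxx andbT; split; first by apply/and5P; split=> //; nia.
  by congr (_, _, _); apply: val_inj; rewrite /= subnKC ?inordK // ltnW.
- move=> [[a x] [b y]] /= /andP[/and5P[a0 x0 b0 y0 /eqP En] /eqP/val_inj Exy].
  rewrite -Exy in En *.
  have b_le : (a + b < n.+1)%N by nia.
  rewrite /f /g /= !inordK //; split; first by rewrite x0 a0 /= andbT; apply/andP; split; nia.
  by congr (_, _, (_, _)); apply: val_inj; rewrite /= addKn inordK.
Qed.

(** The index type is bounded by [n] rather than [m], so that one type serves all the factors of a
    convolution. *)
Lemma sum_divisors (n m : nat) (F : nat -> nat -> rat) : (0 < m <= n)%N ->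
  \sum_(q : 'I_n.+1 * 'I_n.+1 | (q.1 * q.2 == m)%N) F q.1 q.2 =
  \sum_(d <- divisors m) F d (m %/ d)%N.
Proof.
move=> /andP[m_gt0 le_mn].
rewrite -(pair_big_dep xpredT (fun a x : 'I_n.+1 => (a * x == m)%N) (fun a x => F a x)) /=.
rewrite (perm_big [seq d <- index_iota 0 n.+1 | (d %| m)%N]); last first.
  apply: uniq_perm; rewrite ?divisors_uniq ?filter_uniq ?iota_uniq // => d.
  rewrite -dvdn_divisors // mem_filter mem_index_iota /=.
  by case: (boolP (d %| m)%N) => // /(dvdn_leq m_gt0); rewrite ltnS => /leq_trans ->.
rewrite big_filter big_mkord [RHS]big_mkcond; apply: eq_bigr => a _.
case: (boolP (a %| m)%N) => [/dvdnP[k Em] | a_ndvd].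
  have a_gt0 : (0 < a)%N by case: (nat_of_ord a) Em m_gt0 => // ->; rewrite muln0.
  have k_le : (k < n.+1)%N by nia.
  rewrite (big_pred1 (Ordinal k_le)) ?Em ?mulnK // => x.
  by rewrite mulnC eqn_pmul2r.
by rewrite big1 // => x /eqP Em; rewrite -Em dvdn_mulr in a_ndvd.
Qed.

Lemma sum_divisors_convolution (n : nat) (F G : nat -> rat) :
  \sum_(1 <= m < n)
    (\sum_(d <- divisors m) F d) * (\sum_(d <- divisors (n - m)) G d) =
  rsum n (fun _ _ _ _ => true) (fun a x b y => F a * G b).
Proof.
rewrite big_nat_cond.
under eq_bigr => m /andP[/andP[m_gt0 lt_mn] _].
  rewrite -(@sum_divisors n m (fun d _ => F d)) ?m_gt0 1?ltnW //.
  rewrite -(@sum_divisors n (n - m) (fun d _ => G d)) ?subn_gt0 ?lt_mn ?leq_subr //.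
  rewrite big_distrlr /= pair_big /=.
  over.
rewrite (exchange_big_dep (fun p => reps n p && true)) /=; last first.
  move=> m [[a x] [b y]] /andP[/andP[m_gt0 lt_mn] _] /= /andP[/eqP E1 /eqP E2].
  by rewrite andbT; apply/and5P; split; nia.
apply: eq_bigr => -[[a x] [b y]] /andP[/and5P[a0 x0 b0 y0 /eqP En] _] /=.
(* A representation determines m = a x, so the inner sum has a single term. *)
rewrite -big_filter (_ : [seq _ <- _ | _] = [:: (a * x)%N]) ?big_seq1 //.
apply: perm_small_eq => //; apply: uniq_perm; rewrite ?filter_uniq ?iota_uniq // => m.
rewrite mem_filter mem_index_iota inE; lia.
Qed.

Lemma liouville (n : nat) (h : nat -> nat -> rat) : (0 < n)%N ->
    (forall a b, h a b = h b a) -> (forall a b, h a (a + b)%N = h b (a + b)%N) ->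
  rsum n (fun _ _ _ _ => true) (fun a x b y => h a b - h a (a + b)%N) =
  \sum_(d <- divisors n)
    ((n%:R / d%:R - 1) * h d d - \sum_(1 <= a < d) h a d).
Proof.
move=> n_gt0 hC hD.
have -> : rsum n (fun _ _ _ _ => true) (fun a x b y => h a b - h a (a + b)%N) =
    rsum n (fun _ _ _ _ => true) (fun a x b y => h a b)
    - rsum n (fun _ _ _ _ => true) (fun a x b y => h a (a + b)%N).
  by rewrite /rsum sumrB.
have lower : rsum n (fun a x b y => (b < a)%N) (fun a x b y => h a b) =
    rsum n (fun a x b y => (a < b)%N) (fun a x b y => h a b).
  by rewrite rsum_swap; apply: eq_rsum => a x b y _ _ _; apply: hC.
have lower' : rsum n (fun a x b y => (x < y)%N) (fun a x b y => h a (a + b)%N) =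
    rsum n (fun a x b y => (y < x)%N) (fun a x b y => h a (a + b)%N).
  by rewrite rsum_swap; apply: eq_rsum => a x b y _ _ _; rewrite addnC hD.
(* The first sum is cut by comparing [a] with [b], the second by comparing [x] with [y]. The shear
   identifies the off-diagonal pieces, which cancel. *)
rewrite (rsum_split n (fun a x b y => a) (fun a x b y => b)) lower rsum_shear.
rewrite (rsum_split n (fun a x b y => x) (fun a x b y => y)) lower'.
set u := rsum _ _ _; set v := rsum _ _ _; set w := rsum _ _ _.
have -> : u + u + v - (u + u + w) = v - w by ring.
have pos (q : 'I_n.+1 * 'I_n.+1) :
    (q.1 * q.2 == n)%N && (0 < q.2)%N = (q.1 * q.2 == n)%N.
  by case: eqP => //= En; move: n_gt0; rewrite -{1}En muln_gt0 => /andP[].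
rewrite sumrB; congr (_ - _).
(* For a = b = d, the equation d (x + y) = n has n / d - 1 positive solutions. Transposition brings
   this diagonal to the form of [rsum_diag]. *)
- rewrite {}/v rsum_transpose.
  rewrite (_ : rsum _ _ _ = rsum n (fun a x b y => x == y) (fun a x b y => h x x));
    last by apply: eq_rsum => a x b y _ _ /eqP->.
  rewrite (rsum_diag n (fun a b x => h x x)) (eq_bigl _ _ pos).
  pose swap (q : 'I_n.+1 * 'I_n.+1) := (q.2, q.1).
  rewrite (@reindex_bij_on _ _ (fun q : 'I_n.+1 * 'I_n.+1 => q.1 * q.2 == n)%N
    _ swap swap) /=; first last.
  + by case=> a x; rewrite /= mulnC.
  + by case=> a x; rewrite /= mulnC.
  rewrite (@sum_divisors n n (fun a x => \sum_(1 <= i < x) h a a)) ?n_gt0 ?leqnn //.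
  rewrite big_seq [RHS]big_seq; apply: eq_bigr => d; rewrite -dvdn_divisors // => dvd_dn.
  have d_gt0 := dvdn_gt0 n_gt0 dvd_dn.
  have nd_gt0 : (0 < n %/ d)%N by rewrite divn_gt0 // dvdn_leq.
  have -> : n%:R / d%:R - 1 = (n %/ d - 1)%:R :> rat.
    rewrite natrB // -{1}(divnK dvd_dn) natrM mulfK //.
    by rewrite Num.Theory.pnatr_eq0 -lt0n.
  by rewrite sumr_const_nat mulr_natl.
- rewrite {}/w (rsum_diag n (fun a b x => h a (a + b)%N)) (eq_bigl _ _ pos).
  rewrite -(@sum_divisors n n (fun d _ => \sum_(1 <= a < d) h a d)) ?n_gt0 ?leqnn //.
  apply: eq_bigr => q _; rewrite big_nat [RHS]big_nat.
  by apply: eq_bigr => a /andP[_ /ltnW/subnKC->].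
Qed.

(** * Convolution relations between divisor sums *)

(** The constant term is forced to 0, so that products are the convolutions of the theorem; the
    Eisenstein constants are added separately. *)
Definition sigma_series (k : nat) : fps :=
  Fps (fun n => if n == 0%N then 0 else (sigma k n)%:R).

Lemma sigma_series0 (k : nat) : sigma_series k 0%N = 0.
Proof. by []. Qed.

Lemma sigma_seriesE (k n : nat) : (0 < n)%N -> sigma_series k n = (sigma k n)%:R.
Proof. by case: n. Qed.

Lemma sigma_series_divisors (k n : nat) : (0 < n)%N ->
  sigma_series k n = \sum_(d <- divisors n) d%:R ^+ k.
Proof.
move=> n_gt0; rewrite sigma_seriesE // natr_sum.
by apply: eq_bigr => d _; rewrite natrX.
Qed.

Lemma sigma_seriesM (i j n : nat) : (0 < n)%N ->
  (sigma_series i * sigma_series j) n =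
  rsum n (fun _ _ _ _ => true) (fun a x b y => a%:R ^+ i * b%:R ^+ j).
Proof.
move=> n_gt0; rewrite fps_coefM0 // -(sum_divisors_convolution n (fun a => a%:R ^+ i)).
rewrite big_nat [RHS]big_nat; apply: eq_bigr => m /andP[m_gt0 lt_mn].
by rewrite !sigma_series_divisors ?subn_gt0.
Qed.

Lemma sum_antidifference (f g : rat -> rat) (n : nat) : (0 < n)%N -> g 1 = 0 ->
  (forall x, g (x + 1) = g x + f x) -> \sum_(1 <= a < n) f a%:R = g n%:R.
Proof.
move=> n_gt0 g1 gS.
rewrite (@telescope_sumr_eq _ 1 n (fun a => g a%:R) (fun a => f a%:R)) ?g1 ?subr0 //.
by move=> a _; rewrite -natr1 gS addrC addKr.
Qed.

(* In the instances below [G] comes from Faulhaber's formulas.  The trapezoidal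
   correction [- H d d] in [G d d] is what removes the even-indexed series
   produced by the diagonal [a = b]. *)
Lemma sigma_series_relation (k : nat) (e : rat) (H G : rat -> rat -> rat)
    (cs : seq (rat * (nat * nat))) (ds : seq (rat * nat)) :
    (forall x y, H x y = H y x) -> (forall x y, H x (x + y) = H y (x + y)) ->
    (forall x y, H x y - H x (x + y) =
                 \sum_(c <- cs) c.1 * (x ^+ c.2.1 * y ^+ c.2.2)) ->
    (forall x, H x x = e * x ^+ k.+1) ->
    (forall d, G 1 d = 0) -> (forall x d, G (x + 1) d = G x d + H x d) ->
    (forall d, G d d = \sum_(c <- ds) c.1 * d ^+ c.2 - e * d ^+ k.+1) ->
  forall n, \sum_(c <- cs) c.1 * (sigma_series c.2.1 * sigma_series c.2.2) n =
            e * theta (sigma_series k) n - \sum_(c <- ds) c.1 * sigma_series c.2 n.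
Proof.
move=> HC HD Hcs Hdiag G1 GS Gds [|n].
  rewrite !big1 => [|c _|c _]; rewrite ?fps_coef_theta ?sigma_series0 ?mulr0 ?subr0 //.
  by rewrite fps_coefM0 // big_geq // mulr0.
set N := n.+1; have N_gt0 : (0 < N)%N by [].
transitivity (rsum N (fun _ _ _ _ => true)
    (fun a x b y => H a%:R b%:R - H a%:R (a + b)%N%:R)).
  under eq_bigr => c _ do rewrite sigma_seriesM // /rsum mulr_sumr.
  by rewrite exchange_big; apply: eq_bigr => p _; rewrite natrD Hcs.
rewrite (@liouville N (fun a b => H a%:R b%:R)) //; last first.
  by move=> a b; rewrite natrD HD.
rewrite fps_coef_theta sigma_series_divisors // !mulr_sumr.
under [X in _ - X]eq_bigr => c _ do rewrite sigma_series_divisors // mulr_sumr.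
rewrite exchange_big -sumrB big_seq [RHS]big_seq; apply: eq_bigr => d.
rewrite -dvdn_divisors // => /(dvdn_gt0 N_gt0) d_gt0.
rewrite (@sum_antidifference (fun x => H x d%:R) (fun x => G x d%:R)) // Gds Hdiag.
have d_neq0 : d%:R != 0 :> rat by rewrite Num.Theory.pnatr_eq0 -lt0n.
(* As H(d, d) = e d^(k+1), the factor n / d gives e n d^k, which is the [theta] term; the remaining
   - e d^(k+1) cancels against [G d d]. *)
by rewrite /= exprS; field.
Qed.

(** The invariants used satisfy h(a, a + b) = h(a, - b), so h(a, b) - h(a, a + b) is twice the part
    of h odd in b; this is why only odd-index divisor sums are multiplied. Here the difference is -
    2 a b. *)
Lemma sigma_series_square1 :
  12 * sigma_series 1 ^+ 2 =
  5 * sigma_series 3 + sigma_series 1 - 6 * theta (sigma_series 1).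
Proof.
apply: fpsP => n.
unshelve epose proof (@sigma_series_relation 1 1
  (fun x y => (x ^+ 2 - x * y + y ^+ 2))
  (fun x d => 1 / 3 * x ^+ 3 - 1 / 2 * x ^+ 2 * d - 1 / 2 * x ^+ 2
    + x * d ^+ 2 + 1 / 2 * x * d + 1 / 6 * x - d ^+ 2)
  [:: (- 2, (1%N, 1%N))]
  [:: (5 / 6, 3%N); (1 / 6, 1%N)]
  _ _ _ _ _ _ _ n) as eq_n;
  try by move=> *; rewrite ?(big_cons, big_nil) /=; field.
move: eq_n; rewrite !big_cons !big_nil /=.
rewrite expr2 !(fps_coefD, fps_coefN, fps_coef_natM); lra.
Qed.

Lemma sigma_series_1_3 :
  240 * (sigma_series 1 * sigma_series 3) =
  21 * sigma_series 5 + 10 * sigma_series 3 - sigma_series 1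
  - 30 * theta (sigma_series 3).
Proof.
apply: fpsP => n.
unshelve epose proof (@sigma_series_relation 3 1
  (fun x y => (x ^+ 2 - x * y + y ^+ 2) ^+ 2)
  (fun x d => 1 / 5 * x ^+ 5 - 1 / 2 * x ^+ 4 * d - 1 / 2 * x ^+ 4
    + x ^+ 3 * d ^+ 2 + x ^+ 3 * d + 1 / 3 * x ^+ 3 - x ^+ 2 * d ^+ 3
    - 3 / 2 * x ^+ 2 * d ^+ 2 - 1 / 2 * x ^+ 2 * d + x * d ^+ 4 + x * d ^+ 3
    + 1 / 2 * x * d ^+ 2 - 1 / 30 * x - d ^+ 4)
  [:: (- 4, (3%N, 1%N)); (- 4, (1%N, 3%N))]
  [:: (7 / 10, 5%N); (1 / 3, 3%N); (- (1 / 30), 1%N)]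
  _ _ _ _ _ _ _ n) as eq_n;
  try by move=> *; rewrite ?(big_cons, big_nil) /=; field.
move: eq_n; rewrite !big_cons !big_nil /=.
rewrite ?expr2 !(fps_coefD, fps_coefN, fps_coef_natM).
by rewrite [sigma_series 3 * sigma_series 1]mulrC; lra.
Qed.

(** The cube of the quadratic invariant also produces a^3 b^3, hence the square of [sigma_series 3];
    it is removed later by [sigma_series_square3]. *)
Lemma sigma_series_1_5 :
  420 * (12 * (sigma_series 1 * sigma_series 5) + 14 * sigma_series 3 ^+ 2) =
  249 * sigma_series 7 + 210 * sigma_series 5 - 49 * sigma_series 3
  + 10 * sigma_series 1 - 420 * theta (sigma_series 5).
Proof.
apply: fpsP => n.
unshelve epose proof (@sigma_series_relation 5 1
  (fun x y => (x ^+ 2 - x * y + y ^+ 2) ^+ 3)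
  (fun x d => 1 / 7 * x ^+ 7 - 1 / 2 * x ^+ 6 * d - 1 / 2 * x ^+ 6
    + 6 / 5 * x ^+ 5 * d ^+ 2 + 3 / 2 * x ^+ 5 * d + 1 / 2 * x ^+ 5
    - 7 / 4 * x ^+ 4 * d ^+ 3 - 3 * x ^+ 4 * d ^+ 2 - 5 / 4 * x ^+ 4 * d
    + 2 * x ^+ 3 * d ^+ 4 + 7 / 2 * x ^+ 3 * d ^+ 3 + 2 * x ^+ 3 * d ^+ 2
    - 1 / 6 * x ^+ 3 - 3 / 2 * x ^+ 2 * d ^+ 5 - 3 * x ^+ 2 * d ^+ 4
    - 7 / 4 * x ^+ 2 * d ^+ 3 + 1 / 4 * x ^+ 2 * d + x * d ^+ 6
    + 3 / 2 * x * d ^+ 5 + x * d ^+ 4 - 1 / 5 * x * d ^+ 2 + 1 / 42 * x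
    - d ^+ 6)
  [:: (- 6, (5%N, 1%N)); (- 14, (3%N, 3%N)); (- 6, (1%N, 5%N))]
  [:: (83 / 140, 7%N); (1 / 2, 5%N); (- (7 / 60), 3%N); (1 / 42, 1%N)]
  _ _ _ _ _ _ _ n) as eq_n;
  try by move=> *; rewrite ?(big_cons, big_nil) /=; field.
move: eq_n; rewrite !big_cons !big_nil /=.
rewrite ?expr2 !(fps_coefD, fps_coefN, fps_coef_natM).
by rewrite [sigma_series 5 * sigma_series 1]mulrC; lra.
Qed.

(** The invariant (a b (a - b))^2 vanishes on a = b, so [e = 0] and no derivative occurs. With
    constant terms restored this is E4^2 = E8. *)
Lemma sigma_series_square3 :
  120 * sigma_series 3 ^+ 2 = sigma_series 7 - sigma_series 3.
Proof.
apply: fpsP => n.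
unshelve epose proof (@sigma_series_relation 5 0
  (fun x y => (x * y * (x - y)) ^+ 2)
  (fun x d => 1 / 5 * x ^+ 5 * d ^+ 2 - 1 / 2 * x ^+ 4 * d ^+ 3
    - 1 / 2 * x ^+ 4 * d ^+ 2 + 1 / 3 * x ^+ 3 * d ^+ 4 + x ^+ 3 * d ^+ 3
    + 1 / 3 * x ^+ 3 * d ^+ 2 - 1 / 2 * x ^+ 2 * d ^+ 4
    - 1 / 2 * x ^+ 2 * d ^+ 3 + 1 / 6 * x * d ^+ 4 - 1 / 30 * x * d ^+ 2)
  [:: (- 4, (3%N, 3%N))]
  [:: (1 / 30, 7%N); (- (1 / 30), 3%N)]
  _ _ _ _ _ _ _ n) as eq_n;
  try by move=> *; rewrite ?(big_cons, big_nil) /=; field.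
move: eq_n; rewrite !big_cons !big_nil /=.
rewrite expr2 !(fps_coefD, fps_coefN, fps_coef_natM); lra.
Qed.

(** The product of the two generating invariants; it encodes E4 E6 = E10. *)
Lemma sigma_series_3_5 :
  5040 * (sigma_series 3 * sigma_series 5) =
  11 * sigma_series 9 - 21 * sigma_series 5 + 10 * sigma_series 3.
Proof.
apply: fpsP => n.
unshelve epose proof (@sigma_series_relation 7 0
  (fun x y => (x ^+ 2 - x * y + y ^+ 2) * (x * y * (x - y)) ^+ 2)
  (fun x d => 1 / 7 * x ^+ 7 * d ^+ 2 - 1 / 2 * x ^+ 6 * d ^+ 3
    - 1 / 2 * x ^+ 6 * d ^+ 2 + 4 / 5 * x ^+ 5 * d ^+ 4
    + 3 / 2 * x ^+ 5 * d ^+ 3 + 1 / 2 * x ^+ 5 * d ^+ 2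
    - 3 / 4 * x ^+ 4 * d ^+ 5 - 2 * x ^+ 4 * d ^+ 4 - 5 / 4 * x ^+ 4 * d ^+ 3
    + 1 / 3 * x ^+ 3 * d ^+ 6 + 3 / 2 * x ^+ 3 * d ^+ 5
    + 4 / 3 * x ^+ 3 * d ^+ 4 - 1 / 6 * x ^+ 3 * d ^+ 2
    - 1 / 2 * x ^+ 2 * d ^+ 6 - 3 / 4 * x ^+ 2 * d ^+ 5
    + 1 / 4 * x ^+ 2 * d ^+ 3 + 1 / 6 * x * d ^+ 6 - 2 / 15 * x * d ^+ 4
    + 1 / 42 * x * d ^+ 2)
  [:: (- 6, (5%N, 3%N)); (- 6, (3%N, 5%N))]
  [:: (11 / 420, 9%N); (- (1 / 20), 5%N); (1 / 42, 3%N)]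
  _ _ _ _ _ _ _ n) as eq_n;
  try by move=> *; rewrite ?(big_cons, big_nil) /=; field.
move: eq_n; rewrite !big_cons !big_nil /=.
rewrite ?expr2 !(fps_coefD, fps_coefN, fps_coef_natM).
by rewrite [sigma_series 5 * sigma_series 3]mulrC; lra.
Qed.

(** One more factor a^2 - a b + b^2 reaches weight 12, where E4 E8 and E6^2 enter together. *)
Lemma sigma_series_3_7 :
  10080 * (sigma_series 3 * sigma_series 7) + 12600 * sigma_series 5 ^+ 2 =
  13 * sigma_series 11 - 42 * sigma_series 7 + 50 * sigma_series 5
  - 21 * sigma_series 3.
Proof.
apply: fpsP => n.
unshelve epose proof (@sigma_series_relation 9 0
  (fun x y => (x ^+ 2 - x * y + y ^+ 2) ^+ 2 * (x * y * (x - y)) ^+ 2)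
  (fun x d => 1 / 9 * x ^+ 9 * d ^+ 2 - 1 / 2 * x ^+ 8 * d ^+ 3
    - 1 / 2 * x ^+ 8 * d ^+ 2 + 8 / 7 * x ^+ 7 * d ^+ 4 + 2 * x ^+ 7 * d ^+ 3
    + 2 / 3 * x ^+ 7 * d ^+ 2 - 5 / 3 * x ^+ 6 * d ^+ 5 - 4 * x ^+ 6 * d ^+ 4
    - 7 / 3 * x ^+ 6 * d ^+ 3 + 8 / 5 * x ^+ 5 * d ^+ 6 + 5 * x ^+ 5 * d ^+ 5
    + 4 * x ^+ 5 * d ^+ 4 - 7 / 15 * x ^+ 5 * d ^+ 2 - x ^+ 4 * d ^+ 7
    - 4 * x ^+ 4 * d ^+ 6 - 25 / 6 * x ^+ 4 * d ^+ 5 + 7 / 6 * x ^+ 4 * d ^+ 3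
    + 1 / 3 * x ^+ 3 * d ^+ 8 + 2 * x ^+ 3 * d ^+ 7 + 8 / 3 * x ^+ 3 * d ^+ 6
    - 4 / 3 * x ^+ 3 * d ^+ 4 + 2 / 9 * x ^+ 3 * d ^+ 2
    - 1 / 2 * x ^+ 2 * d ^+ 8 - x ^+ 2 * d ^+ 7 + 5 / 6 * x ^+ 2 * d ^+ 5
    - 1 / 3 * x ^+ 2 * d ^+ 3 + 1 / 6 * x * d ^+ 8 - 4 / 15 * x * d ^+ 6
    + 4 / 21 * x * d ^+ 4 - 1 / 30 * x * d ^+ 2)
  [:: (- 8, (7%N, 3%N)); (- 20, (5%N, 5%N)); (- 8, (3%N, 7%N))]
  [:: (13 / 630, 11%N); (- (1 / 15), 7%N); (5 / 63, 5%N); (- (1 / 30), 3%N)]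
  _ _ _ _ _ _ _ n) as eq_n;
  try by move=> *; rewrite ?(big_cons, big_nil) /=; field.
move: eq_n; rewrite !big_cons !big_nil /=.
rewrite ?expr2 !(fps_coefD, fps_coefN, fps_coef_natM).
by rewrite [sigma_series 7 * sigma_series 3]mulrC; lra.
Qed.

(** * The product for Delta *)

Definition fps_of_poly (p : {poly int}) : fps := Fps (fun n => (p`_n)%:~R).

Fact fps_of_poly_is_additive : zmod_morphism fps_of_poly.
Proof. by move=> p q; apply: fpsP => n; rewrite /fcoef /= coefB rmorphB. Qed.

HB.instance Definition _ :=
  GRing.isZmodMorphism.Build {poly int} fps fps_of_poly fps_of_poly_is_additive.

Fact fps_of_poly_is_multiplicative : monoid_morphism fps_of_poly.
Proof.
split=> [|p q]; apply: fpsP => n; first by rewrite fps_coef1 /fcoef /= coef1; case: n.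
rewrite fps_coefM /fcoef /= coefM rmorph_sum.
by apply: eq_bigr => i _; rewrite rmorphM.
Qed.

HB.instance Definition _ :=
  GRing.isMonoidMorphism.Build {poly int} fps fps_of_poly fps_of_poly_is_multiplicative.

Lemma coef_fps_of_poly (p : {poly int}) (n : nat) : fps_of_poly p n = (p`_n)%:~R.
Proof. by []. Qed.

Lemma theta_polyXn (k : nat) :
  theta (fps_of_poly 'X^k) = k%:R * fps_of_poly 'X^k.
Proof.
apply: fpsP => n; rewrite fps_coef_theta fps_coef_natM coef_fps_of_poly coefXn.
by case: eqP => [-> | _]; rewrite ?mulr0.
Qed.

Lemma fps_coefXnM (k n : nat) (f : fps) :
  (fps_of_poly 'X^k * f) n = if (n < k)%N then 0 else f (n - k)%N.
Proof.
have term i : fps_of_poly 'X^k i = (i == k)%:R.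
  by rewrite coef_fps_of_poly coefXn; case: eqP.
rewrite fps_coefM; case: (ltnP n k) => [lt_nk | le_kn].
  rewrite big1 // => i _; rewrite term; case: eqP => [Ei | _]; rewrite ?mul0r //.
  by have := ltn_ord i; rewrite Ei ltnS leqNgt lt_nk.
rewrite (bigD1 (Ordinal (le_kn : (k < n.+1)%N))) //= term eqxx mul1r big1 ?addr0 //.
by move=> i; rewrite -val_eqE term => /= /negPf->; rewrite mul0r.
Qed.

Definition geometric (k : nat) : fps := Fps (fun n => (k %| n)%N%:R).

Lemma geometricP (k : nat) : (0 < k)%N -> (1 - fps_of_poly 'X^k) * geometric k = 1.
Proof.
move=> k_gt0; rewrite mulrBl mul1r; apply: fpsP => n.
rewrite fps_coefD fps_coefN fps_coefXnM fps_coef1 /fcoef /=.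
case: ltnP => [lt_nk | le_kn].
  rewrite subr0; case: n lt_nk => [|n] lt_nk; first by rewrite dvdn0.
  by rewrite gtnNdvd.
by rewrite dvdn_subl // subrr; case: n le_kn => //; rewrite leqNgt k_gt0.
Qed.

(** Additivity of logarithmic derivatives, stated without division. *)
Lemma theta_prod (I : Type) (r : seq I) (P : pred I) (f c : I -> fps) :
    (forall i, P i -> theta (f i) = c i * f i) ->
  theta (\prod_(i <- r | P i) f i) =
  (\sum_(i <- r | P i) c i) * \prod_(i <- r | P i) f i.
Proof.
move=> Df; elim/big_rec2: _ => [|i u v Pi IH]; first by rewrite theta1 mul0r.
by rewrite thetaM Df // IH; ring.
Qed.

Lemma theta_delta_partial (N : nat) :
  theta (fps_of_poly (delta_partial N)) =
  (1 - 24 * \sum_(1 <= k < N.+1) k%:R * (geometric k - 1))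
  * fps_of_poly (delta_partial N).
Proof.
rewrite /delta_partial rmorphM rmorph_prod thetaM.
have -> : theta (fps_of_poly 'X) = fps_of_poly 'X.
  by have := theta_polyXn 1; rewrite expr1 mul1r.
rewrite !big_nat (@theta_prod _ _ _ _ (fun k => - (24 * (k%:R * (geometric k - 1))))).
  by rewrite sumrN -mulr_sumr; ring.
move=> k /andP[k_gt0 _]; rewrite rmorphXn rmorphB rmorph1.
set u := 1 - fps_of_poly 'X^k.
have -> : theta (u ^+ 24) = 24 * u ^+ 23 * theta u := thetaX _ _.
(* By [geometricP], [u * geometric k - u] equals 1 - u, that is q^k; this form keeps the factor [u]
   visible. *)
have -> : theta u = - (k%:R * (u * geometric k - u)).
  by rewrite geometricP // /u raddfB /= theta1 theta_polyXn; ring.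
by rewrite [u ^+ 24]exprS; ring.
Qed.

Definition tau_series : fps := Fps (fun n => (tau n)%:~R).

Lemma tau_series_delta_partial (n N : nat) : (n <= N)%N ->
  tau_series n = fps_of_poly (delta_partial N) n.
Proof. by move=> le_nN; rewrite coef_fps_of_poly delta_partial_coef. Qed.

(** Coefficients up to [n] are unchanged when the infinite product is replaced by its partial
    product at [n], and a sum of k over those k that divide i is [sigma 1 i]. *)
Lemma theta_tau_series : theta tau_series = (1 - 24 * sigma_series 1) * tau_series.
Proof.
apply: fpsP => n; rewrite fps_coef_theta (@tau_series_delta_partial n n) //.
rewrite -fps_coef_theta theta_delta_partial !fps_coefM; apply: eq_bigr => i _.
have le_in : (i <= n)%N := ltn_ord i.
rewrite (@tau_series_delta_partial _ n) ?leq_subr //; congr (_ * _).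
rewrite !(fps_coefD, fps_coefN, fps_coef_natM); congr (_ - _ * _).
rewrite (big_morph (fun f : fps => f i) (fun f g => fps_coefD f g i)
  (erefl : (0 : fps) i = 0)).
under eq_bigr => k _ do rewrite fps_coef_natM fps_coefD fps_coefN fps_coef1.
case: (posnP i) => [-> | i_gt0].
  by rewrite big1 // => k _; rewrite /fcoef /= dvdn0 subrr mulr0.
rewrite sigma_series_divisors //.
transitivity (\sum_(d <- [seq d <- index_iota 1 n.+1 | (d %| i)%N]) d%:R : rat).
  rewrite big_filter [RHS]big_mkcond; apply: eq_bigr => d _.
  rewrite /fcoef /= subr0.
  by case: (d %| i)%N; rewrite ?mulr1 ?mulr0.
rewrite (perm_big (divisors i)) /=; first by apply: eq_bigr => d _; rewrite expr1.
apply: uniq_perm; rewrite ?divisors_uniq ?filter_uniq ?iota_uniq // => d.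
rewrite -dvdn_divisors // mem_filter mem_index_iota ltnS.
case: (boolP (d %| i)%N) => //= dvd_di.
by rewrite (dvdn_gt0 i_gt0 dvd_di) (leq_trans (dvdn_leq i_gt0 dvd_di)).
Qed.

(** * Eisenstein series *)

(** Each use subtracts a multiple of a known equation from the goal; a chain of uses is an explicit
    certificate, and [ring] checks what is left. *)
Lemma linear_combination (c : fps) {l r a b : fps} :
  l = r -> a - c * (l - r) = b -> a = b.
Proof. by move=> -> <-; rewrite subrr mulr0 subr0. Qed.

(** The constants -24, 240, -504, 480, -264 are - 2 k / B_k for k = 2, 4, 6, 8, 10, with B_k the
    Bernoulli numbers. *)
Definition eis2 : fps := 1 - 24 * sigma_series 1.
Definition eis4 : fps := 1 + 240 * sigma_series 3.
Definition eis6 : fps := 1 - 504 * sigma_series 5.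
Definition eis8 : fps := 1 + 480 * sigma_series 7.
Definition eis10 : fps := 1 - 264 * sigma_series 9.

Lemma theta_1D (k : nat) (f : fps) : theta (1 + k%:R * f) = k%:R * theta f.
Proof. by rewrite raddfD /= theta1 add0r theta_natM. Qed.

Lemma theta_1B (k : nat) (f : fps) : theta (1 - k%:R * f) = - (k%:R * theta f).
Proof. by rewrite raddfB /= theta1 sub0r theta_natM. Qed.

Lemma eis4_sqr : eis4 ^+ 2 = eis8.
Proof.
by rewrite /eis4 /eis8; apply: (linear_combination 480 sigma_series_square3); ring.
Qed.

Lemma eis4_eis6 : eis4 * eis6 = eis10.
Proof.
by rewrite /eis4 /eis6 /eis10; apply: (linear_combination (- 24) sigma_series_3_5); ring.
Qed.

(** Since 65 * 1008 = 65520, the right-hand side is 691 E12. *)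
Lemma eis12_relation :
  441 * eis4 ^+ 3 + 250 * eis6 ^+ 2 = 691 + 65 * 1008 * sigma_series 11.
Proof.
apply: (linear_combination (441 * eis4) eis4_sqr); rewrite /eis4 /eis6 /eis8.
apply: (linear_combination 5040 sigma_series_3_7); ring.
Qed.

(** * Ramanujan's differential equations *)

Lemma theta_eis2 : 12 * theta eis2 = eis2 ^+ 2 - eis4.
Proof.
have Deis2 : theta eis2 = - (24 * theta (sigma_series 1)) := theta_1B _ _.
rewrite Deis2 /eis2 /eis4.
apply: (linear_combination (- 48) sigma_series_square1); ring.
Qed.

Lemma theta_eis4 : 3 * theta eis4 = eis2 * eis4 - eis6.
Proof.
have Deis4 : theta eis4 = 240 * theta (sigma_series 3) := theta_1D _ _.
rewrite Deis4 /eis2 /eis4 /eis6.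
apply: (linear_combination 24 sigma_series_1_3); ring.
Qed.

Lemma theta_eis6 : 2 * theta eis6 = eis2 * eis6 - eis4 ^+ 2.
Proof.
have Deis6 : theta eis6 = - (504 * theta (sigma_series 5)) := theta_1B _ _.
apply: (@fps_natM_inj 5) => //; rewrite Deis6.
apply: (linear_combination 5 eis4_sqr); rewrite /eis2 /eis6 /eis4 /eis8.
apply: (linear_combination (- 12) sigma_series_1_5).
apply: (linear_combination 588 sigma_series_square3); ring.
Qed.

(** As E2 has constant term 1, comparing coefficients expresses (n - 1) f(n) through earlier ones;
    only the coefficient of q is free. *)
Lemma theta_eis2_eigen_uniq (f : fps) :
  theta f = eis2 * f -> f 1%N = 0 -> f = 0.
Proof.
move=> Df f1; apply: fpsP => n; rewrite [RHS](_ : _ = 0) //.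
elim/ltn_ind: n => n IHn.
have := congr1 (fun g : fps => g n) Df; rewrite fps_coef_theta fps_coefM.
rewrite big_ord_recl subn0 big1 ?addr0 => [|i _]; last first.
  rewrite IHn ?mulr0 //= /bump; have := ltn_ord i; lia.
have -> : eis2 (ord0 : 'I_n.+1) = 1 by rewrite fps_coefD fps_coefN fps_coef_natM.
rewrite mul1r => /eqP; rewrite -subr_eq0 -{2}[f n]mul1r -mulrBl mulf_eq0.
case: (n =P 1%N) => [-> // | /eqP n_neq1 /orP[|/eqP//]].
by rewrite subr_eq0 Num.Theory.pnatr_eq1 (negPf n_neq1).
Qed.

Lemma tau1 : tau 1 = 1.
Proof.
rewrite /tau /delta_partial big_nat1 mulrC coefMX /= -horner_coef0 !hornerE.
by rewrite expr1n.
Qed.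

Lemma tau_eisenstein : 1728 * tau_series = eis4 ^+ 3 - eis6 ^+ 2.
Proof.
apply/eqP; rewrite -subr_eq0; apply/eqP; apply: theta_eis2_eigen_uniq.
  rewrite !raddfB /= theta_natM theta_tau_series -/eis2 !exprS expr0 !mulr1 !thetaM.
  (* In theta (E4^3 - E6^2) the two cross terms E4^2 E6 cancel, which leaves E2 (E4^3 - E6^2). *)
  apply: (linear_combination (- eis4 ^+ 2) theta_eis4).
  apply: (linear_combination eis6 theta_eis6); ring.
(* The coefficients of q agree: 3 * 240 + 2 * 504 = 1728. *)
rewrite fps_coefD fps_coefN fps_coef_natM.
have c4 : eis4 0%N = 1 by rewrite fps_coefD fps_coef_natM.
have c6 : eis6 0%N = 1 by rewrite fps_coefD fps_coefN fps_coef_natM.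
have s1 k : sigma_series k 1%N = 1 by rewrite sigma_series_divisors // big_seq1 expr1n.
have d4 : eis4 1%N = 240 by rewrite fps_coefD fps_coef_natM fps_coef1 s1 mulr1 add0r.
have d6 : eis6 1%N = - 504.
  by rewrite fps_coefD fps_coefN fps_coef_natM fps_coef1 s1 mulr1 add0r.
have M0 f g : (f * g : fps) 0%N = f 0%N * g 0%N by rewrite fps_coefM big_ord1.
have M1 f g : (f * g : fps) 1%N = f 0%N * g 1%N + f 1%N * g 0%N.
  by rewrite fps_coefM big_ord_recl big_ord1.
rewrite !exprS expr0 !mulr1 fps_coefD fps_coefN !M1 !M0 c4 c6 d4 d6.
have -> : tau_series 1%N = 1 by rewrite /tau_series /fcoef tau1.
ring.
Qed.

(* The Rankin-Cohen brackets [[E4, E6]_1] and [[E4, E4]_2]. *)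
Lemma bracket46 : 3 * eis6 * theta eis4 - 2 * eis4 * theta eis6 = 1728 * tau_series.
Proof.
apply: (linear_combination eis6 theta_eis4).
apply: (linear_combination (- eis4) theta_eis6).
apply: (linear_combination (- 1) tau_eisenstein); ring.
Qed.

(** Differentiate the equation for E4 once more and eliminate all first derivatives by the three
    differential equations. *)
Lemma theta2_eis4 :
  36 * theta (theta eis4) = 5 * eis2 ^+ 2 * eis4 - 10 * eis2 * eis6 + 5 * eis4 ^+ 2.
Proof.
have eq4 : 3 * theta (theta eis4) = theta eis2 * eis4 + eis2 * theta eis4 - theta eis6.
  by rewrite -theta_natM theta_eis4 raddfB /= thetaM.
apply: (linear_combination 12 eq4).
apply: (linear_combination eis4 theta_eis2).
apply: (linear_combination (4 * eis2) theta_eis4).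
apply: (linear_combination (- 6) theta_eis6); ring.
Qed.

Lemma theta2_eis6 :
  24 * theta (theta eis6) =
  7 * eis2 ^+ 2 * eis6 - 14 * eis2 * eis4 ^+ 2 + 7 * eis4 * eis6.
Proof.
have eq6 : 2 * theta (theta eis6) =
    theta eis2 * eis6 + eis2 * theta eis6 - 2 * eis4 * theta eis4.
  by rewrite -theta_natM theta_eis6 raddfB /= thetaM thetaX expr1.
apply: (linear_combination 12 eq6).
apply: (linear_combination eis6 theta_eis2).
apply: (linear_combination (6 * eis2) theta_eis6).
apply: (linear_combination (- 8 * eis4) theta_eis4); ring.
Qed.

Lemma theta2_tau_series :
  12 * theta (theta tau_series) = (13 * eis2 ^+ 2 - eis4) * tau_series.
Proof.
rewrite theta_tau_series -/eis2 thetaM theta_tau_series -/eis2.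
apply: (linear_combination tau_series theta_eis2); ring.
Qed.

Lemma bracket44 :
  4 * eis4 * theta (theta eis4) - 5 * theta eis4 ^+ 2 = 960 * tau_series.
Proof.
apply: (@fps_natM_inj 9) => //.
apply: (linear_combination eis4 theta2_eis4).
(* The multiplier contains the sum of the two sides of [theta_eis4], so a difference of squares
   replaces the squared derivative. *)
apply: (linear_combination (- 5 * (3 * theta eis4 + (eis2 * eis4 - eis6))) theta_eis4).
apply: (linear_combination (- 5) tau_eisenstein); ring.
Qed.

Lemma theta2_eis12 :
  65 * 1008 * theta (theta (sigma_series 11)) =
  441 * (3 * eis4 ^+ 2 * theta (theta eis4) + 6 * eis4 * theta eis4 ^+ 2)
  + 500 * (eis6 * theta (theta eis6) + theta eis6 ^+ 2).
Proof.
have D12 : 65 * 1008 * theta (sigma_series 11) =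
    441 * (3 * eis4 ^+ 2 * theta eis4) + 250 * (2 * eis6 * theta eis6).
  have -> : 65 * 1008 * theta (sigma_series 11) =
      theta (691 + 65 * 1008 * sigma_series 11).
    by rewrite raddfD /= theta_nat -!mulrA !theta_natM add0r.
  by rewrite -eis12_relation raddfD /= !theta_natM !thetaX expr1.
have -> : 65 * 1008 * theta (theta (sigma_series 11)) =
    theta (65 * 1008 * theta (sigma_series 11)) by rewrite -!mulrA !theta_natM.
rewrite D12 raddfD /= !theta_natM !thetaM ?thetaX !theta_nat ?expr1; ring.
Qed.

(** Common source of the last three identities, all in weight 16. The squared derivative of E6
    yields their shared convolution; they differ only in how E4 Delta is then written as a
    bracket. *)
Lemma theta2_tau_eis12 :
  70 * 144 * (12 * 756) * theta (theta tau_series) =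
  120 * (65 * 1008 * theta (theta (sigma_series 11)))
  + 691 * 70 * 1728 * eis4 * tau_series - 520 * 691 * theta eis6 ^+ 2.
Proof.
apply: (@fps_natM_inj 72) => //.
apply: (linear_combination (- (72 * 120)) theta2_eis12).
apply: (linear_combination (70 * 144 * (12 * 756) * 6) theta2_tau_series).
apply: (linear_combination (- (6 * 120 * 441 * eis4 ^+ 2)) theta2_eis4).
apply: (linear_combination (- (3 * 120 * 500 * eis6)) theta2_eis6).
apply: (linear_combination
  (- (48 * 120 * 441 * eis4 * (3 * theta eis4 + (eis2 * eis4 - eis6)))) theta_eis4).
apply: (linear_combination
  ((18 * 520 * 691 - 18 * 120 * 500)
   * (2 * theta eis6 + (eis2 * eis6 - eis4 ^+ 2))) theta_eis6).
apply: (linear_combination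
  (6 * (72 * 735) * (13 * eis2 ^+ 2 - eis4) - 72 * 691 * 70 * eis4) tau_eisenstein).
ring.
Qed.

(** * Translation from Eisenstein series to divisor sums *)

Lemma theta_eis4E : theta eis4 = 240 * theta (sigma_series 3).
Proof. exact: theta_1D. Qed.

Lemma theta2_eis4E : theta (theta eis4) = 240 * theta (theta (sigma_series 3)).
Proof. by rewrite theta_eis4E theta_natM. Qed.

Lemma theta_eis6E : theta eis6 = - (504 * theta (sigma_series 5)).
Proof. exact: theta_1B. Qed.

Lemma theta_eis8E : 2 * eis4 * theta eis4 = 480 * theta (sigma_series 7).
Proof.
have <- : theta eis8 = 480 * theta (sigma_series 7) by apply: theta_1D.
by rewrite -eis4_sqr thetaX expr1.
Qed.

Lemma theta2_eis8E :
  2 * theta eis4 ^+ 2 + 2 * eis4 * theta (theta eis4) =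
  480 * theta (theta (sigma_series 7)).
Proof.
have -> : 480 * theta (theta (sigma_series 7)) = theta (2 * eis4 * theta eis4).
  by rewrite theta_eis8E theta_natM.
by rewrite -[2 * eis4 * theta eis4]mulrA theta_natM thetaM; ring.
Qed.

Lemma theta_eis10E :
  theta eis4 * eis6 + eis4 * theta eis6 = - (264 * theta (sigma_series 9)).
Proof.
have <- : theta eis10 = - (264 * theta (sigma_series 9)) by apply: theta_1B.
by rewrite -eis4_eis6 thetaM.
Qed.

(** Expansion of [bracket46]; the constant terms of E4 and E6 produce the isolated divisor sums. *)
Lemma tau_series_35 :
  12 * tau_series = 5 * theta (sigma_series 3) + 7 * theta (sigma_series 5)
  + 840 * (2 * (sigma_series 3 * theta (sigma_series 5))
           - 3 * (theta (sigma_series 3) * sigma_series 5)).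
Proof.
apply: (@fps_natM_inj 144) => //.
apply: (linear_combination (- 1) bracket46).
apply: (linear_combination (3 * eis6) theta_eis4E).
apply: (linear_combination (- 2 * eis4) theta_eis6E).
by rewrite /eis4 /eis6; ring.
Qed.

Lemma tau_series_33 :
  tau_series = theta (theta (sigma_series 3))
  + 60 * (4 * (sigma_series 3 * theta (theta (sigma_series 3)))
          - 5 * (theta (sigma_series 3) * theta (sigma_series 3))).
Proof.
apply: (@fps_natM_inj 960) => //.
apply: (linear_combination (- 1) bracket44).
apply: (linear_combination (4 * eis4) theta2_eis4E).
apply: (linear_combination
  (- 5 * (theta eis4 + 240 * theta (sigma_series 3))) theta_eis4E).
by rewrite /eis4; ring.
Qed.

(** E4 times the bracket of E4 and E6 is 3/2 E6 theta E8 - 2 E8 theta E6, by E8 = E4^2. *)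
Lemma theta2_tau_series_57 :
  12 * (756 * theta (theta tau_series)) =
  780 * theta (theta (sigma_series 11)) + 5 * (691 * theta (sigma_series 7))
  + 7 * (691 * theta (sigma_series 5))
  - 168 * (5 * (691 * (3 * (sigma_series 5 * theta (sigma_series 7))
                     - 4 * (theta (sigma_series 5) * sigma_series 7))))
  - 1008 * (13 * (691 * (theta (sigma_series 5) * theta (sigma_series 5)))).
Proof.
apply: (@fps_natM_inj 70) => //; apply: (@fps_natM_inj 144) => //.
apply: (linear_combination 1 theta2_tau_eis12).
apply: (linear_combination (- (691 * 70 * eis4)) bracket46).
apply: (linear_combination (691 * 105 * eis6) theta_eis8E).
apply: (linear_combination (- (691 * 140 * theta eis6)) eis4_sqr).
apply: (linear_combination (- (691 * 140 * eis8)
  - 520 * 691 * (theta eis6 - 504 * theta (sigma_series 5))) theta_eis6E).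
by rewrite /eis4 /eis6 /eis8; ring.
Qed.

(** E4 times [bracket44] is, up to a factor, the second bracket of E4 and E8, whence the
    coefficients 10, -45, 36. *)
Lemma theta2_tau_series_37 :
  24 * (441 * theta (theta tau_series)) =
  910 * theta (theta (sigma_series 11))
  + 9 * (691 * theta (theta (sigma_series 3)))
  + 5 * (691 * theta (theta (sigma_series 7)))
  + 24 * (5 * (691 * (10 * (sigma_series 3 * theta (theta (sigma_series 7)))
                       - 45 * (theta (sigma_series 3) * theta (sigma_series 7))
                       + 36 * (theta (theta (sigma_series 3)) * sigma_series 7))))
  - 1176 * (13 * (691 * (theta (sigma_series 5) * theta (sigma_series 5)))).
Proof.
apply: (@fps_natM_inj 72) => //; apply: (@fps_natM_inj 120) => //.
apply: (linear_combination 1 theta2_tau_eis12).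
apply: (linear_combination (- (691 * 126 * eis4)) bracket44).
apply: (linear_combination (691 * 9 * 36 * theta (theta eis4)) eis4_sqr).
apply: (linear_combination (691 * 9 * 36 * eis8) theta2_eis4E).
apply: (linear_combination (- (691 * 9 * 45 * theta eis4)) theta_eis8E).
apply: (linear_combination
  (- (691 * 9 * 45 * (480 * theta (sigma_series 7)))) theta_eis4E).
apply: (linear_combination (691 * 90 * eis4) theta2_eis8E).
apply: (linear_combination
  (- 520 * 691 * (theta eis6 - 504 * theta (sigma_series 5))) theta_eis6E).
by rewrite /eis4 /eis6 /eis8; ring.
Qed.

(** E4 times the bracket of E4 and E6 is also 5 E10 theta E4 - 2 E4 theta E10, by E10 = E4 E6. *)
Lemma theta2_tau_series_39 :
  36 * (756 * theta (theta tau_series)) =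
  2340 * theta (theta (sigma_series 11)) + 25 * (691 * theta (sigma_series 3))
  + 11 * (691 * theta (sigma_series 9))
  - 24 * (55 * (691 * (5 * (theta (sigma_series 3) * sigma_series 9)
                     - 2 * (sigma_series 3 * theta (sigma_series 9)))))
  - 3024 * (13 * (691 * (theta (sigma_series 5) * theta (sigma_series 5)))).
Proof.
apply: (@fps_natM_inj 3360) => //.
apply: (linear_combination 1 theta2_tau_eis12).
apply: (linear_combination (- (691 * 70 * eis4)) bracket46).
apply: (linear_combination (691 * 350 * theta eis4) eis4_eis6).
apply: (linear_combination (- (691 * 140 * eis4)) theta_eis10E).
apply: (linear_combination (691 * 350 * eis10) theta_eis4E).
apply: (linear_combination
  (- 520 * 691 * (theta eis6 - 504 * theta (sigma_series 5))) theta_eis6E).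
by rewrite /eis4 /eis6 /eis10; ring.
Qed.

(** * The five identities *)

(** The division by n^2, with n and all sums abstracted to field elements so that [field] meets only
    variables and constants. *)
Lemma solve_tau_57 (F : numFieldType) (x t a b c S U : F) : x != 0 ->
    12 * (756 * (x * (x * t))) =
    780 * (x * (x * a)) + 5 * (691 * (x * b)) + 7 * (691 * (x * c))
    - 168 * (5 * (691 * S)) - 1008 * (13 * (691 * U)) ->
  t = 65 / 756 * a + (5 * 691) / (12 * 756 * x) * b
      + 691 / (12 * 108 * x) * c - (5 * 691) / (54 * x ^+ 2) * S
      - (13 * 691) / (9 * x ^+ 2) * U.
Proof.
move=> x_neq0 eq_t.
have d_neq0 : 12 * 756 * x ^+ 2 != 0.
  by rewrite !mulf_neq0 ?expf_neq0 ?Num.Theory.pnatr_eq0.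
apply: (mulfI d_neq0).
transitivity (12 * (756 * (x * (x * t)))); first by ring.
by rewrite eq_t; field.
Qed.

Lemma solve_tau_37 (F : numFieldType) (x t a b c S U : F) : x != 0 ->
    24 * (441 * (x * (x * t))) =
    910 * (x * (x * a)) + 9 * (691 * (x * (x * b))) + 5 * (691 * (x * (x * c)))
    + 24 * (5 * (691 * S)) - 1176 * (13 * (691 * U)) ->
  t = 65 / 756 * a + (3 * 691) / (8 * 441) * b + (5 * 691) / (24 * 441) * c
      + (5 * 691) / (441 * x ^+ 2) * S - (13 * 691) / (9 * x ^+ 2) * U.
Proof.
move=> x_neq0 eq_t.
have d_neq0 : 24 * 441 * x ^+ 2 != 0.
  by rewrite !mulf_neq0 ?expf_neq0 ?Num.Theory.pnatr_eq0.
apply: (mulfI d_neq0).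
transitivity (24 * (441 * (x * (x * t)))); first by ring.
by rewrite eq_t; field.
Qed.

Lemma solve_tau_39 (F : numFieldType) (x t a b c S U : F) : x != 0 ->
    36 * (756 * (x * (x * t))) =
    2340 * (x * (x * a)) + 25 * (691 * (x * b)) + 11 * (691 * (x * c))
    - 24 * (55 * (691 * S)) - 3024 * (13 * (691 * U)) ->
  t = 65 / 756 * a + (25 * 691) / (36 * 756 * x) * b
      + (11 * 691) / (36 * 756 * x) * c - (55 * 691) / (1134 * x ^+ 2) * S
      - (13 * 691) / (9 * x ^+ 2) * U.
Proof.
move=> x_neq0 eq_t.
have d_neq0 : 36 * 756 * x ^+ 2 != 0.
  by rewrite !mulf_neq0 ?expf_neq0 ?Num.Theory.pnatr_eq0.
apply: (mulfI d_neq0).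
transitivity (36 * (756 * (x * (x * t)))); first by ring.
by rewrite eq_t; field.
Qed.

(** [theta] multiplies by m on the first factor and by n - m on the second, so a weight is to be
    expanded in m and n - m. *)
Lemma sigma_convolution1 (i j n : nat) (a b : rat) (c : nat -> rat) :
    (forall m, c m = a * (n%:R - m%:R) - b * m%:R) ->
  \sum_(1 <= m < n) c m * (sigma i m)%:R * (sigma j (n - m))%:R =
  a * (sigma_series i * theta (sigma_series j)) n
  - b * (theta (sigma_series i) * sigma_series j) n.
Proof.
move=> cE; rewrite !fps_coefM0 // !mulr_sumr -sumrB.
apply: eq_big_nat => m /andP[m_gt0 lt_mn]; rewrite /= cE !fps_coef_theta.
by rewrite !sigma_seriesE ?subn_gt0 // natrB ?(ltnW lt_mn) //;
  move: (sigma _ _) (sigma _ _) => u v; ring.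
Qed.

Lemma sigma_convolution1_opp (i j n : nat) (a b : rat) (c : nat -> rat) :
    (forall m, c m = b * m%:R - a * (n%:R - m%:R)) ->
  \sum_(1 <= m < n) c m * (sigma i m)%:R * (sigma j (n - m))%:R =
  b * (theta (sigma_series i) * sigma_series j) n
  - a * (sigma_series i * theta (sigma_series j)) n.
Proof.
move=> cE; rewrite -opprB -(@sigma_convolution1 i j n a b (fun m => - c m)).
  by rewrite -sumrN; apply: eq_bigr => m _; rewrite !mulNr opprK.
by move=> m; rewrite cE opprB.
Qed.

Lemma sigma_convolution2 (i j n : nat) (a b d : rat) (c : nat -> rat) :
    (forall m, c m =
       a * (n%:R - m%:R) ^+ 2 - b * (m%:R * (n%:R - m%:R)) + d * m%:R ^+ 2) ->
  \sum_(1 <= m < n) c m * (sigma i m)%:R * (sigma j (n - m))%:R =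
  a * (sigma_series i * theta (theta (sigma_series j))) n
  - b * (theta (sigma_series i) * theta (sigma_series j)) n
  + d * (theta (theta (sigma_series i)) * sigma_series j) n.
Proof.
move=> cE; rewrite !fps_coefM0 // !mulr_sumr -sumrB -big_split.
apply: eq_big_nat => m /andP[m_gt0 lt_mn]; rewrite /= cE !fps_coef_theta.
by rewrite !sigma_seriesE ?subn_gt0 // natrB ?(ltnW lt_mn) //;
  move: (sigma _ _) (sigma _ _) => u v; ring.
Qed.

Theorem theorem2p6 (n : nat) (hn : (1 <= n)%N) :
  [/\ (* (i) *)
      (tau n)%:~R =
        5 / 12 * n%:R * (sigma 3 n)%:R + 7 / 12 * n%:R * (sigma 5 n)%:R
        + 70 * \sum_(1 <= m < n)
            (2 * n%:R - 5 * m%:R) * (sigma 3 m)%:R * (sigma 5 (n - m))%:R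
        :> rat,
      (* (ii) *)
      (tau n)%:~R =
        n%:R ^+ 2 * (sigma 3 n)%:R
        + 60 * \sum_(1 <= m < n)
            (4 * n%:R ^+ 2 - 13 * m%:R * n%:R + 9 * m%:R ^+ 2)
            * (sigma 3 m)%:R * (sigma 3 (n - m))%:R
        :> rat,
      (* (iii) *)
      (tau n)%:~R =
        65 / 756 * (sigma 11 n)%:R
        + (5 * 691) / (12 * 756 * n%:R) * (sigma 7 n)%:R
        + 691 / (12 * 108 * n%:R) * (sigma 5 n)%:R
        - (5 * 691) / (54 * n%:R ^+ 2) * \sum_(1 <= m < n)
            (3 * n%:R - 7 * m%:R) * (sigma 5 m)%:R * (sigma 7 (n - m))%:R
        - (13 * 691) / (9 * n%:R ^+ 2) * \sum_(1 <= m < n)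
            m%:R * (n%:R - m%:R) * (sigma 5 m)%:R * (sigma 5 (n - m))%:R
        :> rat,
      (* (iv) *)
      (tau n)%:~R =
        65 / 756 * (sigma 11 n)%:R
        + (3 * 691) / (8 * 441) * (sigma 3 n)%:R
        + (5 * 691) / (24 * 441) * (sigma 7 n)%:R
        + (5 * 691) / (441 * n%:R ^+ 2) * \sum_(1 <= m < n)
            (91 * m%:R ^+ 2 - 65 * m%:R * n%:R + 10 * n%:R ^+ 2)
            * (sigma 3 m)%:R * (sigma 7 (n - m))%:R
        - (13 * 691) / (9 * n%:R ^+ 2) * \sum_(1 <= m < n)
            m%:R * (n%:R - m%:R) * (sigma 5 m)%:R * (sigma 5 (n - m))%:R
        :> rat
    & (* (v) *)
      (tau n)%:~R =
        65 / 756 * (sigma 11 n)%:R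
        + (25 * 691) / (36 * 756 * n%:R) * (sigma 3 n)%:R
        + (11 * 691) / (36 * 756 * n%:R) * (sigma 9 n)%:R
        - (55 * 691) / (1134 * n%:R ^+ 2) * \sum_(1 <= m < n)
            (7 * m%:R - 2 * n%:R) * (sigma 3 m)%:R * (sigma 9 (n - m))%:R
        - (13 * 691) / (9 * n%:R ^+ 2) * \sum_(1 <= m < n)
            m%:R * (n%:R - m%:R) * (sigma 5 m)%:R * (sigma 5 (n - m))%:R
        :> rat].
Proof.
have n_neq0 : n%:R != 0 :> rat by rewrite Num.Theory.pnatr_eq0 -lt0n.
have tauE : tau_series n = (tau n)%:~R by [].
have sE k : sigma_series k n = (sigma k n)%:R by apply: sigma_seriesE.
have coefE := (fps_coefD, fps_coefN, fps_coef_natM, fps_coef_theta, sE, tauE).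
pose S55 : rat := \sum_(1 <= m < n)
  m%:R * (n%:R - m%:R) * (sigma 5 m)%:R * (sigma 5 (n - m))%:R.
have S55E : (theta (sigma_series 5) * theta (sigma_series 5)) n = S55.
  rewrite fps_coefM0 //; apply: eq_big_nat => m /andP[m_gt0 lt_mn].
  rewrite !fps_coef_theta !sigma_seriesE ?subn_gt0 // natrB ?(ltnW lt_mn) //.
  by move: (sigma 5 m) (sigma 5 _) => u v; ring.
split; rewrite -?/S55.
- rewrite (@sigma_convolution1 3 5 n 2 3) => [|m]; last by ring.
  have := congr1 (fun f : fps => f n) tau_series_35; rewrite !coefE.
  by move: ((_ * theta _) n) ((theta _ * _) n) => A B; lra.
(* 4 n^2 - 13 m n + 9 m^2 = 4 (n - m)^2 - 5 m (n - m), with no m^2 term left. *)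
- rewrite (@sigma_convolution2 3 3 n 4 5 0) => [|m]; last by ring.
  rewrite (mul0r (_ n)) addr0.
  have := congr1 (fun f : fps => f n) tau_series_33; rewrite !coefE => ->.
  by rewrite expr2 mulrA.
- rewrite (@sigma_convolution1 5 7 n 3 4) => [|m]; last by ring.
  apply: (@solve_tau_57 rat _ _ _ _ _ _ _ n_neq0).
  have := congr1 (fun f : fps => f n) theta2_tau_series_57.
  by rewrite !coefE S55E.
(* 91 m^2 - 65 m n + 10 n^2 = 10 (n - m)^2 - 45 m (n - m) + 36 m^2. *)
- rewrite (@sigma_convolution2 3 7 n 10 45 36) => [|m]; last by ring.
  apply: (@solve_tau_37 rat _ _ _ _ _ _ _ n_neq0).
  have := congr1 (fun f : fps => f n) theta2_tau_series_37.
  by rewrite !coefE S55E.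
- rewrite (@sigma_convolution1_opp 3 9 n 2 5) => [|m]; last by ring.
  apply: (@solve_tau_39 rat _ _ _ _ _ _ _ n_neq0).
  have := congr1 (fun f : fps => f n) theta2_tau_series_39.
  by rewrite !coefE S55E.
Qed.
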